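(* Let $K$ be a field of arbitrary characteristic and let $m$ be a positive integer. Let $S^{(m+1,m+1)}$ be the Specht module of the symmetric group algebra $K\mathfrak{S}_{2m+2}$ corresponding to the partition $(m+1,m+1)$, and for $0\le k\le[(m+1)/2]$ let $S^{(m+1-k,k)}$ be the Specht module of $K\mathfrak{S}_{m+1}$ corresponding to the partition $(m+1-k,k)$. Then $$\sum_{k=0}^{[(m+1)/2]}\bigl(\dim_K S^{(m+1-k,k)}\bigr)^2=\dim_K S^{(m+1,m+1)}.$$
   Context: $[x]$ denotes the largest integer not bigger than $x$. $\mathfrak{S}_r$ is the symmetric group on $r$ letters. For a partition $\lambda$ of $r$, the Specht module of $K\mathfrak{S}_r$ corresponding to $\lambda$ is the associated cell module of $K\mathfrak{S}_r$; its dimension is the number of standard $\lambda$-tableaux. *)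

(* Defs.v *)
From mathcomp Require Import all_boot all_order all_algebra all_fingroup.
From mathcomp Require Import all_character.

Set Implicit Arguments.
Unset Strict Implicit.
Unset Printing Implicit Defensive.

Import GRing.Theory.
Local Open Scope nat_scope.

(* Trailing zero parts are allowed, so that (n, 0) and (n) are the same        *)
(* partition of n.                                                             *)
Definition is_intpart (n : nat) (la : seq nat) : bool :=
  sorted geq la && (sumn la == n).

(* Dominance order; [take] saturates, so the lengths of la and mu may differ. *)
Definition dominates (n : nat) (mu la : seq nat) : bool :=
  [forall i : 'I_n.+1, sumn (take i la) <= sumn (take i mu)].

Definition strictly_dominates (n : nat) (mu la : seq nat) : bool :=
  dominates n mu la && ~~ dominates n la mu.

(* Row stabiliser of the initial tableau t^la, which is filled with 0, 1, ... *)
(* along successive rows: [reshape_index la i] is the row of t^la holding i.  *)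
Definition young_subgroup (n : nat) (la : seq nat) : {set 'S_n} :=
  [set s : 'S_n |
    [forall i : 'I_n, reshape_index la (s i) == reshape_index la i]].

Section Specht.

Variables (K : fieldType) (n : nat).

Local Notation G := [set: 'S_n].
Local Notation aG := (regular_repr K G).

(* The right regular module K'S_n is 'rV[K]_#|G|, and [gring_row] sends an    *)
(* element of the group algebra, seen as a matrix, to its coordinate vector.  *)
(* The next vector is g * x_la, where x_la is the sum of the elements of the  *)
(* Young subgroup of la.                                                      *)
Definition young_sum_row (la : seq nat) (g : 'S_n) : 'rV[K]_#|G| :=
  gring_row (aG g *m gset_mx K G (young_subgroup n la))%R.

(* The two-sided ideal generated by the x_mu, for the partitions mu of n that *)
(* strictly dominate la. It is the ideal K'S_n(|> la) of the cellular algebra *)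
(* K'S_n, spanned by the elements d(s)^-1 * x_mu * d(t) of the Murphy basis,  *)
(* for s and t standard mu-tableaux with mu |> la.                            *)
Definition cell_ideal (la : seq nat) : 'M[K]_#|G| :=
  (\sum_(mu : n.-tuple 'I_n.+1 |
           is_intpart n (map val mu) && strictly_dominates n (map val mu) la)
     \sum_(g in G) cyclic_mx aG (young_sum_row (map val mu) g))%MS.

Lemma cell_ideal_module (la : seq nat) : mxmodule aG (cell_ideal la).
Proof.
apply: sumsmx_module => mu _; apply: sumsmx_module => g _.
exact: cyclic_mx_module.
Qed.

(* The cell module of la for the Murphy basis: the submodule of               *)
(* K'S_n / K'S_n(|> la) generated by the image of x_la.                       *)
Definition Specht (la : seq nat) : representation K G :=
  Representation
    (section_repr (cell_ideal_module la)
                  (cyclic_mx_module aG (young_sum_row la 1%g))).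

End Specht.

(* Main.v *)
Require Import Defs.
From mathcomp Require Import all_boot all_order all_algebra all_fingroup.
From mathcomp Require Import all_character.
From mathcomp Require Import zify.

(** Both sides count lattice walks. For [2 * k <= n] the Specht module of
    [(n - k, k)] has dimension the number of ballot subsets of size [k] of
    {0, .., n - 1}: those with at most half of each initial segment. These are
    the second rows of the standard tableaux. Reading an element of the subset
    as a down step and any other element as an up step turns them into the
    walks of length [n] on the half-line from 0 to [n - 2 * k]
    ([card_ballot_sets]). A closed walk of length [2 * n] is a walk from 0 to
    some height, followed by the reversal of another such walk; hence the
    squares of the numbers of walks of length [n] add up to the number of
    closed walks of length [2 * n] ([sum_walks_sqr]).

    The dimension is computed over any field, without the Murphy basis. Write
    [A -> B] for the sum of the permutations [p] with [p @: A = B]. The cell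
    ideal [U] is spanned by the [A -> B] with [#|A| = #|B| < k]
    ([mem_cell_ideal], [cell_ideal_sub]), and the right ideal [V] generated by
    the Young subgroup sum is spanned by the tabloids [R -> B], where [R] is
    the second row of the initial tableau and [#|B| = k]
    ([mem_permutation_module], [permutation_module_sub]). The Specht module is
    [(U + V) / U].

    It is spanned by the ballot tabloids ([tabloid_span]): a set [B] that fails
    the ballot condition at [i] is rewritten by a Garnir relation, which holds
    modulo [U], in terms of sets with a larger sum of elements.

    These are independent modulo [U] ([exists_polytabloid]). A ballot set [S]
    has an injection [m] into its complement with [m s < s]. The signed sum of
    coefficients that is antisymmetric under every transposition of [s] and
    [m s] kills [U], since a set [B] with fewer than [k] elements misses both
    [s] and [m s] for some [s]. On the tabloids of sets whose sum is at least
    that of [S], it is the coordinate of [S], since every swap decreases the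
    sum; so the matrix of values on ballot tabloids is unitriangular. *)

Set Implicit Arguments.
Unset Strict Implicit.
Unset Printing Implicit Defensive.

Import GRing.Theory.
Local Open Scope nat_scope.

(** * Walks on the half-line *)

(** The number of walks of length [n] from 0 to [h] with steps 1 and -1 that stay
    nonnegative, by cases on the last step. *)
Fixpoint walks (n h : nat) : nat :=
  if n is n'.+1 then walks n' h.+1 + (if h is h'.+1 then walks n' h' else 0)
  else h == 0.

Lemma walks_gt n h : n < h -> walks n h = 0.
Proof.
by elim: n h => [|n IHn] [|h] //= lt_nh; rewrite !IHn //; lia.
Qed.

Lemma walks_parity n h : odd n != odd h -> walks n h = 0.
Proof.
elim: n h => [|n IHn] [|h] //= nh; rewrite !IHn //=; move: nh; case: (odd n);
by rewrite ?negbK //; case: (odd h).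
Qed.

(** The step operator on functions of the height is self-adjoint. The truncation
    at [N] is harmless because the walks considered do not reach [N + 1]. *)
Lemma sum_walks_shift N i j : i <= N -> j <= N ->
  \sum_(h < N.+1) walks i.+1 h * walks j h
  = \sum_(h < N.+1) walks i h * walks j.+1 h.
Proof.
move=> le_iN le_jN.
under eq_bigr => h _ do rewrite /= mulnDl.
under [RHS]eq_bigr => h _ do rewrite /= mulnDr.
rewrite !big_split /=.
rewrite [X in _ + X = _]big_ord_recl [X in _ = _ + X]big_ord_recl /=.
rewrite [X in X + _ = _]big_ord_recr [X in _ = X + _]big_ord_recr /=.
rewrite (walks_gt (h := N.+1)) // (walks_gt (n := j) (h := N.+1)) //.
by rewrite !muln0 !mul0n !addn0 !add0n addnC.
Qed.

(** Moving the steps one by one from the right factor to the left one turns the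
    sum of squares into a sum over the endpoint of a walk of length 0. *)
Lemma sum_walks_sqr n :
  \sum_(h < n.*2.+1) walks n h * walks n h = walks n.*2 0.
Proof.
have shift d : d <= n ->
    \sum_(h < n.*2.+1) walks n h * walks n h
    = \sum_(h < n.*2.+1) walks (n + d) h * walks (n - d) h.
  elim: d => [|d IHd] lt_dn; first by rewrite addn0 subn0.
  rewrite IHd; last by lia.
  have -> : n - d = (n - d.+1).+1 by lia.
  by rewrite -sum_walks_shift ?addnS //; lia.
rewrite (shift n) // subnn addnn big_ord_recl big1 ?muln1 ?addn0 // => i _.
by rewrite muln0.
Qed.

Lemma sum_parity (F : nat -> nat) n :
  (forall h, odd n != odd h -> F h = 0) ->
  \sum_(0 <= k < (n %/ 2).+1) F (n - k.*2) = \sum_(h < n.+1) F h.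
Proof.
rewrite divn2; elim/ltn_ind: n => -[|[|n]] IHn F0.
- by rewrite big_nat1 big_ord1.
- by rewrite big_nat1 !big_ord_recr big_ord0 /= (F0 0).
rewrite big_nat_recl //= 2!big_ord_recr /= (F0 n.+1) /=; last first.
  by rewrite negbK; case: (odd n).
by rewrite addn0 addnC -IHn // => h; have := F0 h; rewrite /= negbK.
Qed.

(** * Ballot sets *)

Definition below n (S : {set 'I_n}) (i : nat) := #|[set x in S | x < i]|.

Lemma below0 n (S : {set 'I_n}) : below S 0 = 0.
Proof. by apply: eq_card0 => x; rewrite inE ltn0 andbF. Qed.

Lemma belowS n (S : {set 'I_n}) (x : 'I_n) :
  below S x.+1 = below S x + (x \in S).
Proof.
rewrite /below (cardsD1 x) inE ltnSn andbT addnC; congr (_ + _).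
apply: eq_card => y; rewrite !inE -(inj_eq val_inj) /= ltnS.
by case: (y \in S); rewrite ?andbF //= ltn_neqAle.
Qed.

Lemma below_full n (S : {set 'I_n}) : below S n = #|S|.
Proof. by apply: eq_card => x; rewrite inE ltn_ord andbT. Qed.

Lemma below_mono n (S : {set 'I_n}) i j : i <= j -> below S i <= below S j.
Proof.
move=> le_ij; apply/subset_leq_card/subsetP => x; rewrite !inE.
by case/andP=> -> /leq_trans ->.
Qed.

Lemma below_lt n (S : {set 'I_n}) (x : 'I_n) j :
  x \in S -> x < j -> below S x < below S j.
Proof. by move=> Sx /(below_mono S); rewrite belowS Sx addn1. Qed.

Lemma below_inj n (S : {set 'I_n}) :
  {in S &, injective (fun x : 'I_n => below S x)}.
Proof.
move=> x y Sx Sy /= eq_xy; case: (ltngtP x y) => [lt_xy | lt_yx | /val_inj //].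
  by have := below_lt Sx lt_xy; rewrite eq_xy ltnn.
by have := below_lt Sy lt_yx; rewrite eq_xy ltnn.
Qed.


Lemma belowC n (S : {set 'I_n}) i : i <= n -> below S i + below (~: S) i = i.
Proof.
elim: i => [|i IHi] lt_in; first by rewrite !below0.
rewrite !(belowS _ (Ordinal lt_in)) inE /=.
by have := IHi (ltnW lt_in); case: (_ \in S) => /=; lia.
Qed.

(** The condition that the elements of [S] can be the second row of a standard
    two-row tableau whose first row is the complement of [S]. *)
Definition ballot n (S : {set 'I_n}) :=
  [forall i : 'I_n.+1, (below S i).*2 <= i].

Lemma ballotP n (S : {set 'I_n}) :
  reflect (forall i, i <= n -> (below S i).*2 <= i) (ballot S).
Proof.
apply: (iffP forallP) => balS i; last by apply: balS; rewrite -ltnS.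
by rewrite -ltnS => lt_i; apply: (balS (Ordinal lt_i)).
Qed.

Definition ballot_sets n k := [set S : {set 'I_n} | ballot S & #|S| == k].

Definition widen n (S : {set 'I_n}) : {set 'I_n.+1} :=
  widen_ord (leqnSn n) @: S.

Definition unwiden n (S : {set 'I_n.+1}) : {set 'I_n} :=
  widen_ord (leqnSn n) @^-1: S.

Lemma widen_inj n : injective (widen_ord (leqnSn n)).
Proof. by move=> x y /(congr1 val) /= /val_inj. Qed.

Lemma mem_widen n (S : {set 'I_n}) x :
  (widen_ord (leqnSn n) x \in widen S) = (x \in S).
Proof. by rewrite mem_imset //; apply: widen_inj. Qed.

Lemma max_widen n (S : {set 'I_n}) : ord_max \notin widen S.
Proof.
apply/imsetP => -[x _ /(congr1 val) /= eq_n].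
by have := ltn_ord x; rewrite -eq_n ltnn.
Qed.

Lemma card_widen n (S : {set 'I_n}) : #|widen S| = #|S|.
Proof. by apply: card_imset; apply: widen_inj. Qed.

Lemma widenK n : cancel (@widen n) (@unwiden n).
Proof. by move=> S; apply/setP=> x; rewrite inE mem_widen. Qed.

Lemma ordS_case n (x : 'I_n.+1) :
  x = ord_max \/ exists y, x = widen_ord (leqnSn n) y.
Proof.
have [lt_xn | le_nx] := ltnP x n; [right | left].
  by exists (Ordinal lt_xn); apply: val_inj.
by apply/val_inj/eqP; rewrite eqn_leq le_nx -ltnS ltn_ord.
Qed.

Lemma unwidenK n (S : {set 'I_n.+1}) : widen (unwiden S) = S :\ ord_max.
Proof.
apply/setP=> x; case: (ordS_case x) => [-> | [y ->]].
  by rewrite !inE eqxx (negPf (max_widen _)).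
rewrite mem_widen !inE; case: eqP => // /(congr1 val) /= eq_n.
by have := ltn_ord y; rewrite eq_n ltnn.
Qed.

Lemma below_unwiden n (S : {set 'I_n.+1}) i :
  i <= n -> below (unwiden S) i = below S i.
Proof.
elim: i => [|i IHi] lt_in; first by rewrite !below0.
rewrite (belowS _ (Ordinal lt_in)).
rewrite (belowS _ (widen_ord (leqnSn n) (Ordinal lt_in))) /=.
by rewrite IHi ?(ltnW lt_in) // inE.
Qed.

(** Only the ballot condition at the end of the segment involves the largest
    element. *)
Lemma ballot_unwiden n (S : {set 'I_n.+1}) :
  ballot S = ballot (unwiden S) && (#|S|.*2 <= n.+1).
Proof.
apply/ballotP/andP => [balS | [/ballotP balS leS] i].
  split; last by rewrite -below_full balS.
  by apply/ballotP => i le_in; rewrite below_unwiden // balS // ltnW.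
rewrite leq_eqVlt => /predU1P[-> | lt_in]; first by rewrite below_full.
by rewrite -below_unwiden // balS.
Qed.

Lemma card_unwiden n (S : {set 'I_n.+1}) :
  #|S| = (ord_max \in S) + #|unwiden S|.
Proof. by rewrite (cardsD1 ord_max) -unwidenK card_widen. Qed.

(** Deleting the largest element is deleting the last step of the walk. *)
Lemma card_ballot_setsS n k : k.*2 <= n.+1 ->
  #|ballot_sets n.+1 k|
  = #|ballot_sets n k| + (if k is k'.+1 then #|ballot_sets n k'| else 0).
Proof.
move=> le_kn.
rewrite -(cardsID [set S : {set 'I_n.+1} | ord_max \notin S]); congr (_ + _).
  rewrite -(card_imset _ (can_inj (@widenK n))); apply: eq_card => S.
  rewrite !inE; apply/andP/imsetP => [[/andP[balS cardS] maxS] | [T]].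
    exists (unwiden S).
      rewrite inE -(eqP cardS) card_unwiden (negPf maxS) eqxx andbT.
      by move: balS; rewrite ballot_unwiden; case/andP.
    by rewrite unwidenK; apply/setP => x; rewrite !inE; case: eqP => // ->;
       rewrite (negPf maxS).
  rewrite inE => /andP[balT /eqP cardT] ->.
  by rewrite max_widen ballot_unwiden widenK balT card_widen cardT le_kn eqxx.
case: k => [|k] in le_kn *.
  apply: eq_card0 => S; rewrite !inE negbK.
  case maxS: (ord_max \in S) => //=; apply/negbTE; rewrite negb_and.
  by apply/orP; right; rewrite -lt0n card_gt0; apply/set0Pn; exists ord_max.
have f_inj : injective (fun S : {set 'I_n} => ord_max |: widen S).
  move=> S T eqST; apply: (can_inj (@widenK n)).
  by rewrite -(setU1K (max_widen S)) eqST setU1K ?max_widen.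
rewrite -(card_imset _ f_inj); apply: eq_card => S.
rewrite !inE negbK; apply/andP/imsetP => [[maxS /andP[balS /eqP cardS]] | [T]].
  exists (unwiden S); last by rewrite unwidenK setD1K.
  move: balS cardS; rewrite inE ballot_unwiden card_unwiden maxS add1n.
  by case/andP=> -> _ [->] /=.
rewrite inE => /andP[balT /eqP cardT] ->.
have cardS : #|ord_max |: widen T| = k.+1.
  by rewrite cardsU1 max_widen card_widen cardT.
rewrite setU11 ballot_unwiden cardS eqxx le_kn !andbT; split=> //.
rewrite (_ : unwiden _ = T) //; apply/setP => x.
rewrite !inE mem_widen; case: eqP => //= /(congr1 val) /= eq_n.
by have := ltn_ord x; rewrite eq_n ltnn.
Qed.

Lemma card_ballot_sets n k :
  k.*2 <= n -> #|ballot_sets n k| = walks n (n - k.*2).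
Proof.
elim: n k => [|n IHn] k le_kn.
  have -> : k = 0 by lia.
  rewrite (_ : ballot_sets 0 0 = [set set0]) ?cards1 //; apply/setP => S.
  rewrite !inE cards_eq0; case: eqP => [->|]; rewrite ?andbF // andbT.
  by apply/ballotP => i _; rewrite /below eq_card0 // => -[].
rewrite card_ballot_setsS //=.
move: le_kn; rewrite leq_eqVlt => /predU1P[eq_kn | le_kn].
  (* Height 0 is reached by a down step only: the largest element belongs to
     every ballot set of this size. *)
  have -> : #|ballot_sets n k| = 0.
    apply: eq_card0 => S; rewrite !inE; apply/andP.
    case=> /ballotP/(_ n (leqnn n)).
    by rewrite below_full => leS /eqP cardS; move: leS; rewrite cardS; lia.
  case: k eq_kn => [|k] // eq_kn; rewrite IHn; last by lia.
  have -> : n.+1 - k.+1.*2 = 0 by lia.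
  have -> : n - k.*2 = 1 by lia.
  by rewrite add0n addn0.
rewrite IHn // subSn // addnC; congr (_ + _).
case: k le_kn => [|k] le_kn; first by rewrite walks_gt // double0 subn0.
rewrite IHn; last by lia.
by congr walks; lia.
Qed.

(** The elements outside [S] that precede a given [s] in [S] outnumber those of
    [S], so the one with the same rank in the complement as [s] has in [S] lies
    below [s]. It is found as the last place where the count of the complement
    has not exceeded the rank of [s]. *)
Lemma ballot_matching n (S : {set 'I_n}) : ballot S ->
  exists m : 'I_n -> 'I_n,
    {in S &, injective m} /\ {in S, forall s, m s < s /\ m s \notin S}.
Proof.
move=> /ballotP balS.
have ex_m s : s \in S ->
    exists y : 'I_n, [/\ y < s, y \notin S & below (~: S) y = below S s].
  move=> Ss.
  have ltSs: below S s < below (~: S) s.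
    have := belowC S (ltnW (ltn_ord s)); have := balS s.+1 (ltn_ord s).
    by rewrite belowS Ss; lia.
  pose P y := (y <= s) && (below (~: S) y <= below S s).
  have exP: exists y, P y by exists 0; rewrite /P below0.
  have bdP y: P y -> y <= s by case/andP.
  case: (ex_maxnP exP bdP) => y /andP[le_ys le_y] max_y.
  have lt_ys: y < s.
    rewrite ltn_neqAle le_ys andbT; apply: contraTneq le_y => ->.
    by rewrite -ltnNge.
  have lt_yn := ltn_trans lt_ys (ltn_ord s).
  have := max_y y.+1; rewrite /P lt_ys ltnn /=.
  rewrite (belowS _ (Ordinal lt_yn)) inE /=.
  case Sy: (_ \in S) => /= lt_y.
    by have := lt_y; rewrite addn0 le_y => /(_ isT).
  by exists (Ordinal lt_yn); rewrite Sy; split=> //=; lia.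
pose m (s : 'I_n) := odflt s [pick y : 'I_n | [&& y < s, y \notin S
                                      & below (~: S) y == below S s]].
have mP s : s \in S ->
    [/\ m s < s, m s \notin S & below (~: S) (m s) = below S s].
  case/ex_m=> y [lt_y Sy eq_y]; rewrite /m.
  case: pickP => [z /and3P[? ? /eqP]|] //=.
  by move/(_ y); rewrite lt_y Sy eq_y eqxx.
exists m; split=> [s t Ss St eq_m | s /mP[]] //.
case/mP: (Ss) (St) => _ _ eq_s /mP[_ _ eq_t].
by apply: (below_inj Ss St); rewrite -eq_s -eq_t eq_m.
Qed.

(** * Indicators of sets of permutations as group algebra elements *)

Section Indicators.
Variables (K : fieldType) (n : nat).
Local Notation G := [set: 'S_n].
Local Notation aG := (regular_repr K G).

(** The group algebra element that is the sum of the permutations in [X], in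
    coordinates. *)
Definition indicator (X : pred 'S_n) : 'rV[K]_#|G| :=
  (\row_i (X (enum_val i))%:R)%R.

Definition maps_onto (A B : {set 'I_n}) : pred 'S_n :=
  fun p => [set p x | x in A] == B.

Lemma eq_indicator (X Y : pred 'S_n) : X =1 Y -> indicator X = indicator Y.
Proof. by move=> eqXY; apply/rowP => i; rewrite !mxE eqXY. Qed.

Lemma indicator_pred1 (p : 'S_n) :
  indicator (pred1 p) = delta_mx 0%R (gring_index G p).
Proof.
apply/rowP => i; rewrite !mxE /= -(inj_eq (can_inj (@gring_valK _ G))).
by rewrite gring_indexK // inE.
Qed.

Lemma gring_row_repr (p : 'S_n) : gring_row (aG p) = indicator (pred1 p).
Proof.
by rewrite indicator_pred1 /gring_row rowK gring_indexK ?mul1g // inE.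
Qed.

(** A two-sided translate of a subgroup sum is again the sum of a set. *)
Lemma young_sum_rowE la (g h : 'S_n) :
  (young_sum_row K la g *m aG h)%R
  = indicator (fun p => (g^-1 * p * h^-1)%g \in young_subgroup n la).
Proof.
rewrite /young_sum_row -gring_row_mul /gset_mx mulmx_sumr mulmx_suml linear_sum.
have inG (x : 'S_n) : x \in G by rewrite inE.
under eq_bigr => y _ do rewrite /= -!repr_mxM // gring_row_repr.
apply/rowP => i; rewrite summxE !mxE /=.
under eq_bigr => y _ do rewrite mxE /=.
set p := enum_val i; set y0 := (g^-1 * p * h^-1)%g.
have eq_p y : (p == g * y * h)%g = (y == y0).
  apply/eqP/eqP => [eq_p | ->].
    by rewrite /y0 eq_p !mulgA mulVg mul1g mulgK.
  by rewrite /y0 !mulgA mulgV mul1g mulgKV.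
under eq_bigr => y _ do rewrite eq_p.
case Yy0: (y0 \in _); first rewrite (bigD1 y0) //= eqxx big1 ?addr0 //.
  by move=> y /andP[_ /negPf->].
by rewrite big1 // => y Yy; case: eqP => // eq_y; rewrite -eq_y Yy in Yy0.
Qed.

(** The second row of the initial tableau of shape [(n - j, j)]. *)
Definition second_row j : {set 'I_n} := [set i : 'I_n | n - j <= i].

Lemma card_second_row j : j <= n -> #|second_row j| = j.
Proof.
move=> le_jn; have := belowC (second_row j) (leq_subr j n).
have -> : below (second_row j) (n - j) = 0.
  by apply: eq_card0 => i; rewrite !inE leqNgt andNb.
have -> : below (~: second_row j) (n - j) = #|~: second_row j|.
  by apply: eq_card => i; rewrite !inE -ltnNge andbb.
by have := cardsC (second_row j); rewrite card_ord; lia.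
Qed.

Lemma perm_imset_eq (A B : {set 'I_n}) (p : 'S_n) :
  ([set p x | x in A] == B) = ([set (p^-1)%g x | x in B] == A).
Proof.
have imK (q : 'S_n) (C : {set 'I_n}) :
    [set (q^-1)%g x | x in [set q x | x in C]] = C.
  by rewrite -imset_comp -[RHS]imset_id; apply: eq_imset => x /=; rewrite permK.
by apply/eqP/eqP => <-; rewrite ?imK // -{1}[p]invgK imK.
Qed.

Lemma imset_permM (A : {set 'I_n}) (p q : 'S_n) :
  [set (p * q)%g x | x in A] = [set q x | x in [set p x | x in A]].
Proof. by rewrite -imset_comp; apply: eq_imset => x; rewrite /= permM. Qed.

(** With two rows, preserving the second row as a set is enough to preserve both. *)
Lemma mem_young_subgroup la j (s : 'S_n) :
  (forall i : 'I_n, reshape_index la i = (n - j <= i)) ->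
  (s \in young_subgroup n la) = maps_onto (second_row j) (second_row j) s.
Proof.
move=> row_la; rewrite inE /maps_onto; apply/forallP/eqP => [sP | sR i].
  apply/eqP; rewrite eqEcard card_imset ?leqnn ?andbT; last exact: perm_inj.
  apply/subsetP => _ /imsetP[i Ri ->]; move: Ri; rewrite !inE.
  by move/eqP: (sP i); rewrite !row_la; do 2!case: (n - j <= _).
rewrite !row_la; have := mem_imset (second_row j) i (@perm_inj _ s).
by rewrite sR !inE => ->.
Qed.

Lemma young_sum_row_maps_onto la j (g h : 'S_n) :
  (forall i : 'I_n, reshape_index la i = (n - j <= i)) ->
  (young_sum_row K la g *m aG h)%R
  = indicator (maps_onto [set (g^-1)%g x | x in second_row j]
                         [set h x | x in second_row j]).
Proof.
move=> row_la; rewrite young_sum_rowE; apply: eq_indicator => p.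
rewrite (mem_young_subgroup _ row_la) /maps_onto !imset_permM perm_imset_eq invgK.
by rewrite eq_sym.
Qed.

Lemma exists_perm_imset (A B : {set 'I_n}) : #|A| = #|B| ->
  exists p : 'S_n, [set p x | x in A] = B.
Proof.
move=> eqAB.
(* [e C] lists all the points, beginning with those of [C]; the wanted
   permutation matches [e A] with [e B]. *)
pose e (C : {set 'I_n}) := enum C ++ enum (~: C).
have mem_e C x : x \in e C by rewrite mem_cat !mem_enum inE orbN.
have uniq_e C : uniq (e C).
  rewrite cat_uniq !enum_uniq andbT; apply/hasPn => x.
  by rewrite !mem_enum inE.
have size_e C : size (e C) = n by rewrite size_cat -!cardE cardsC card_ord.
have lt_index C x : index x (e C) < n.
  by have := mem_e C x; rewrite -index_mem size_e.
pose f x := nth x (e B) (index x (e A)).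
have f_inj : injective f.
  move=> x y /eqP; rewrite /f (set_nth_default x) ?size_e //.
  rewrite nth_uniq ?size_e //.
  by move/eqP/index_inj; apply.
exists (perm f_inj); apply/eqP.
rewrite eqEcard card_imset ?eqAB ?leqnn ?andbT; last exact: perm_inj.
apply/subsetP => _ /imsetP[x Ax ->]; rewrite permE /f !index_cat mem_enum Ax.
have lt_x : index x (enum A) < size (enum B).
  by rewrite -cardE -eqAB cardE index_mem mem_enum.
by rewrite nth_cat lt_x -mem_enum mem_nth.
Qed.

End Indicators.

(** * The cell ideal and the permutation module of a two-row partition *)

Lemma reshape_index_two_rows a b la i :
  i < a + b -> reshape_index [:: a, b & la] i = (a <= i).
Proof.
move=> lt_i; rewrite /reshape_index /=.
have -> : (i.+1 - a == 0) = (i < a) by lia.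
case: ltnP => //= le_ai.
by have -> : i.+1 - a - b == 0 by lia.
Qed.

(** Dominance at 2 leaves no room for a third nonzero part; strictness then makes
    the first part larger than [n - k], for otherwise the two partitions agree. *)
Lemma strictly_dominates_two_rows n k (mu : seq nat) :
  1 < size mu -> 1 < n -> k <= n ->
  is_intpart n mu -> strictly_dominates n mu [:: n - k; k] ->
  exists2 j, j < k & forall i : 'I_n, reshape_index mu i = (n - j <= i).
Proof.
case: mu => [|a [|b mu]] //= _ n_gt1 le_kn /andP[_ /eqP /= sum_mu].
have lt1n : 1 < n.+1 by apply: ltnW.
case/andP=> /forallP dom ndom.
have le_a : n - k <= a.
  by have := dom (Ordinal lt1n); rewrite /= ?take0 /= ?addn0.
have := dom (Ordinal (n_gt1 : 2 < n.+1)); rewrite /= ?take0 /= => le_n.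
have ltk : n - k < a.
  rewrite ltn_neqAle le_a andbT; apply: contra ndom => /eqP eq_a.
  apply/forallP => -[[|[|i]] lt_i] //=; first by rewrite ?take0 /=; lia.
  by have := sumn_cat (take i mu) (drop i mu); rewrite cat_take_drop; lia.
exists b => [|i]; first by lia.
rewrite reshape_index_two_rows; last by have := ltn_ord i; lia.
by congr (nat_of_bool (_ <= i)); lia.
Qed.

(** The partition [(n - j, j)], padded with zeros to length [n]. *)
Lemma exists_two_row_partition n k j : 1 < n -> k.*2 <= n -> j < k ->
  exists mu : n.-tuple 'I_n.+1,
    [/\ is_intpart n (map val mu),
        strictly_dominates n (map val mu) [:: n - k; k]
      & forall i : 'I_n, reshape_index (map val mu) i = (n - j <= i)].
Proof.
move=> n_gt1 le_kn lt_jk.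
pose s := [:: n - j, j & nseq (n - 2) 0].
have size_s : size (map inord s : seq 'I_n.+1) == n.
  by rewrite size_map /= size_nseq; lia.
exists (Tuple size_s).
have -> : map val (Tuple size_s) = s.
  rewrite /= -map_comp; rewrite !inordK ?map_nseq /= ?inordK //; lia.
split.
- rewrite /is_intpart /= sumn_nseq mul0n; apply/andP; split; last by lia.
  apply/andP; split; first by rewrite /geq /=; lia.
  by elim: (n - 2) (j) => //= p IHp q; rewrite IHp.
- apply/andP; split.
    apply/forallP => -[[|[|i]] lt_i] //=; rewrite ?take0 /=; lia.
  apply/negP => /forallP/(_ (Ordinal (ltnW n_gt1 : 1 < n.+1))).
  by rewrite /= ?take0 /=; lia.
by move=> i; rewrite reshape_index_two_rows //; have := ltn_ord i; lia.
Qed.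

Section CellIdeal.
Variables (K : fieldType) (n : nat).
Local Notation G := [set: 'S_n].
Local Notation aG := (regular_repr K G).

Lemma cyclic_mx_subP (u : 'rV[K]_#|G|) m (W : 'M[K]_(m, #|G|)) :
  (forall h, ((u *m aG h)%R <= W)%MS) -> (cyclic_mx aG u <= W)%MS.
Proof.
move=> subW; rewrite genmxE; apply/row_subP => i.
by rewrite row_mul rowK mul_vec_lin_row.
Qed.

Lemma cyclic_mx_memJ (u : 'rV[K]_#|G|) (h : 'S_n) :
  ((u *m aG h)%R <= cyclic_mx aG u)%MS.
Proof.
apply: submx_trans (mxmoduleP (cyclic_mx_module aG u) h _); last by rewrite inE.
by rewrite submxMr ?cyclic_mx_id.
Qed.

Hypothesis n_gt1 : 1 < n.
Variable k : nat.
Hypothesis le_kn : k.*2 <= n.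

Lemma mem_cell_ideal (A B : {set 'I_n}) :
  #|A| < k -> #|A| = #|B| ->
  (indicator K (maps_onto A B) <= cell_ideal K n [:: n - k; k])%MS.
Proof.
move=> lt_jk eqAB; set j := #|A| in lt_jk.
have [mu [mu_part mu_dom row_mu]] := exists_two_row_partition n_gt1 le_kn lt_jk.
have card_j : #|second_row n j| = j by apply: card_second_row; lia.
have [g def_A] := exists_perm_imset (card_j : _ = #|A|).
have [h def_B] := exists_perm_imset (etrans card_j eqAB).
apply: (sumsmx_sup mu); first by rewrite mu_part.
apply: (sumsmx_sup (g^-1)%g); first by rewrite inE.
apply: submx_trans (cyclic_mx_memJ _ h).
by rewrite (young_sum_row_maps_onto _ _ _ row_mu) invgK def_A def_B.
Qed.

Lemma cell_ideal_sub m (W : 'M[K]_(m, #|G|)) :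
  (forall A B : {set 'I_n}, #|A| < k -> #|A| = #|B| ->
     (indicator K (maps_onto A B) <= W)%MS) ->
  (cell_ideal K n [:: n - k; k] <= W)%MS.
Proof.
move=> subW; apply/sumsmx_subP => mu /andP[mu_part mu_dom].
apply/sumsmx_subP => g _; apply: cyclic_mx_subP => h.
have [||j lt_jk row_mu] := strictly_dominates_two_rows _ n_gt1 _ mu_part mu_dom.
- by rewrite size_map size_tuple.
- by lia.
rewrite (young_sum_row_maps_onto _ _ _ row_mu).
have card_j : #|second_row n j| = j by apply: card_second_row; lia.
by apply: subW; rewrite !card_imset ?card_j //; apply: perm_inj.
Qed.

Let row_la (i : 'I_n) : reshape_index [:: n - k; k] i = (n - k <= i).
Proof. by apply: reshape_index_two_rows; rewrite subnK ?ltn_ord //; lia. Qed.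

Lemma mem_permutation_module (B : {set 'I_n}) : #|B| = k ->
  (indicator K (maps_onto (second_row n k) B)
     <= cyclic_mx aG (young_sum_row K [:: n - k; k] 1%g))%MS.
Proof.
move=> cardB.
have card_k : #|second_row n k| = k by apply: card_second_row; lia.
have [h def_B] := exists_perm_imset (etrans card_k (esym cardB)).
apply: submx_trans (cyclic_mx_memJ _ h).
rewrite (young_sum_row_maps_onto _ _ _ row_la) def_B invg1.
by rewrite (eq_imset _ (@perm1 _)) imset_id.
Qed.

Lemma permutation_module_sub m (W : 'M[K]_(m, #|G|)) :
  (forall B : {set 'I_n}, #|B| = k ->
     (indicator K (maps_onto (second_row n k) B) <= W)%MS) ->
  (cyclic_mx aG (young_sum_row K [:: n - k; k] 1%g) <= W)%MS.
Proof.
move=> subW; apply: cyclic_mx_subP => h.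
rewrite (young_sum_row_maps_onto _ _ _ row_la) invg1.
rewrite (eq_imset _ (@perm1 _)) imset_id; apply: subW.
by rewrite card_imset ?card_second_row //; [lia | apply: perm_inj].
Qed.

End CellIdeal.

(** * Spanning the cell module: straightening *)

Definition weight n (S : {set 'I_n}) := \sum_(x in S) (x : nat).

Lemma weight_le n (S : {set 'I_n}) : weight S <= n * n.
Proof.
apply: (@leq_trans (\sum_(x : 'I_n) n)); last by rewrite sum_nat_const card_ord.
rewrite /weight big_mkcond; apply: leq_sum => x _.
by case: ifP => // _; apply: ltnW.
Qed.

(** Passing from [S] to [T] trades elements below [i] for as many elements that
    are at least [i]. *)
Lemma weight_lt n (S T : {set 'I_n}) i : #|S| = #|T| -> S != T ->
  {in S :\: T, forall x : 'I_n, x < i} ->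
  {in T :\: S, forall x : 'I_n, i <= x} ->
  weight S < weight T.
Proof.
move=> eqST neST ltS leT.
have card_diff : #|S :\: T| = #|T :\: S|.
  by have := cardsID T S; have := cardsID S T; rewrite setIC; lia.
rewrite /weight (big_setID T) [X in _ < X](big_setID S) /= setIC ltn_add2l.
have [x STx] : exists x, x \in S :\: T.
  apply/set0Pn; apply: contra neST => /eqP ST0.
  rewrite eqEcard eqST leqnn andbT.
  by rewrite -setD_eq0 ST0.
apply: (@leq_trans (\sum_(y in S :\: T) i)).
  rewrite (bigD1 x) //= [X in _ < X](bigD1 x) //= -addSn leq_add ?ltS //.
  by apply: leq_sum => y /andP[/ltS/ltnW].
rewrite sum_nat_const card_diff -sum_nat_const.
by apply: leq_sum => y /leT.
Qed.

Section Straightening.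
Variables (K : fieldType) (n k : nat).
Hypotheses (n_gt1 : 1 < n) (le_kn : k.*2 <= n).
Local Notation R := (second_row n k).
Local Notation U := (cell_ideal K n [:: n - k; k]).
Local Notation tabloid := (fun B => indicator K (maps_onto R B)).

(** The permutations that send [R] to a set containing [J] and disjoint from [L].
    Their sums are the Garnir elements. *)
Definition covers_avoids (R J L : {set 'I_n}) : pred 'S_n :=
  fun p => (J \subset p @: R) && [disjoint L & p @: R].

(** A permutation whose image of [R] contains [J] takes exactly one subset of [R]
    onto [J]. *)
Lemma indicator_covers (R J : {set 'I_n}) :
  indicator K (fun p => J \subset p @: R)
  = (\sum_(A : {set 'I_n} | (A \subset R) && (#|A| == #|J|))
       indicator K (maps_onto A J))%R.
Proof.
apply/rowP => i; rewrite summxE mxE; set p := enum_val i.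
pose A0 := (p^-1)%g @: J.
have mapA0 (A : {set 'I_n}) : (p @: A == J) = (A == A0).
  by rewrite perm_imset_eq eq_sym.
under eq_bigr => A _ do rewrite mxE /maps_onto -/p mapA0.
have A0R : (A0 \subset R) = (J \subset p @: R).
  have /eqP <- : p @: A0 == J by rewrite mapA0.
  apply/idP/idP => [/imsetS-> // | /subsetP subR]; apply/subsetP => x A0x.
  by rewrite -(mem_imset _ _ (@perm_inj _ p)) subR ?imset_f.
have cardA0 : #|A0| == #|J| by rewrite card_imset //; apply: perm_inj.
case subJ: (J \subset _) A0R => A0R.
  rewrite (bigD1 A0) /= ?A0R // eqxx big1 ?addr0 // => A /andP[_ /negPf].
  by move=> ->.
rewrite big1 // => A /andP[AR _]; case: eqP => // eqA.
by rewrite -eqA AR in A0R.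
Qed.

(** Inclusion-exclusion on [L]: avoiding one more point [x] is the difference of
    not constraining [x] and covering it. Each step keeps the number of covered
    points below [k], so the sums that remain at the end lie in the cell ideal. *)
Lemma indicator_covers_avoids_ideal (J L : {set 'I_n}) :
  #|J| + #|L| < k -> (indicator K (covers_avoids R J L) <= U)%MS.
Proof.
have [c] := ubnP #|L|; elim: c => // c IHc in J L * => leLc ltk.
have [-> | [x Lx]] := set_0Vmem L.
  have -> : indicator K (covers_avoids R J set0)
      = indicator K (fun p => J \subset p @: R).
    apply: eq_indicator => p.
    by rewrite /covers_avoids disjoints_subset sub0set andbT.
  rewrite indicator_covers summx_sub // => A /andP[_ /eqP cardA].
  by apply: mem_cell_ideal => //; rewrite cardA; lia.
have cardL := cardsD1 x L; rewrite Lx in cardL.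
have -> : indicator K (covers_avoids R J L)
  = (indicator K (covers_avoids R J (L :\ x))
     - indicator K (covers_avoids R (x |: J) (L :\ x)))%R.
  apply/rowP => i; rewrite !mxE /covers_avoids; set p := enum_val i.
  rewrite subUset sub1set -{1}(setD1K Lx) !disjoints_subset.
  rewrite subUset sub1set in_setC.
  case: (x \in _); case: (J \subset _); case: (_ \subset _);
  by rewrite ?subrr ?subr0.
have cardJ : #|x |: J| <= #|J|.+1 by rewrite cardsU1; case: (x \in J).
by apply: addmx_sub; rewrite ?eqmx_opp; apply: IHc; lia.
Qed.

(** Straightening. If more than half of the first [i] points are in [B], ask that
    the part of [B] outside these points be covered and that the remaining ones
    among these points be avoided: fewer than [k] constraints in all. So the sum
    of the tabloids that satisfy them lies in the cell ideal. One of these is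
    [B]; the others replace elements below [i] by elements not below [i], and
    are thus heavier. *)
Lemma tabloid_span (B : {set 'I_n}) : #|B| = k ->
  (tabloid B <= U + \sum_(S in ballot_sets n k) <<tabloid S>>)%MS.
Proof.
set E := (\sum_(S in _) _)%MS.
have [c] := ubnP (n * n - weight B); elim: c => // c IHc in B * => leBc cardB.
have [balB | ] := boolP (ballot B).
  apply: submx_trans (addsmxSr _ _).
  apply: (sumsmx_sup B); last by rewrite genmxE.
  by rewrite inE balB cardB eqxx.
case/forallPn => -[i le_in]; rewrite -ltnNge /= => lt_i.
pose P : {set 'I_n} := [set x : 'I_n | x < i].
pose T : {set 'I_n} := B :\: P; pose L : {set 'I_n} := P :\: B.
have cardT : #|T| + below B i = k.
  rewrite -cardB -(cardsID P B) addnC; congr (_ + _).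
  by apply: eq_card => x; rewrite !inE.
have cardL : #|L| + below B i = i.
  rewrite -[RHS](belowC B le_in) addnC; congr (_ + _).
  by apply: eq_card => x; rewrite !inE andbC.
have TL_U : (indicator K (covers_avoids R T L) <= U)%MS.
  by apply: indicator_covers_avoids_ideal; lia.
have card_image (p : 'S_n) : #|p @: R| = k.
  by rewrite card_imset ?card_second_row //; [lia | apply: perm_inj].
pose good (S : {set 'I_n}) := [&& #|S| == k, T \subset S & [disjoint L & S]].
have goodB : good B.
  rewrite /good /T /L cardB eqxx subsetDl.
  by rewrite -setI_eq0 setDE -setIA [~: B :&: B]setIC setICr setI0 eqxx.
have def_B : tabloid B = (indicator K (covers_avoids R T L)
    - \sum_(S | good S && (S != B)) tabloid S)%R.
  apply/eqP; rewrite -subr_eq opprK -(bigD1 B) //; apply/eqP.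
  apply/rowP => j; rewrite summxE mxE; set p := enum_val j.
  under eq_bigr => S _ do rewrite mxE -/p /maps_onto.
  have [goodS | badS] := boolP (good (p @: R)).
    rewrite (bigD1 (p @: R)) //= eqxx big1 ?addr0 => [|S /andP[_ /negPf]].
      by move: goodS; rewrite /good card_image eqxx /= /covers_avoids => ->.
    by rewrite eq_sym => ->.
  rewrite big1 => [|S goodS]; last first.
    by case: eqP => // eqS; rewrite eqS goodS in badS.
  by move: badS; rewrite /good card_image eqxx /= /covers_avoids => /negPf->.
rewrite [X in (X <= _)%MS]def_B.
rewrite addmx_sub ?(submx_trans TL_U) ?addsmxSl // eqmx_opp.
apply: summx_sub => S /andP[/and3P[/eqP cardS TS LS] neS].
apply: IHc => //.
suff : weight B < weight S by have := weight_le S; lia.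
apply: (@weight_lt _ _ _ i); rewrite ?cardB // 1?eq_sym // => x; rewrite inE.
  case/andP=> Sx Bx; rewrite ltnNge; apply: contra Sx => le_ix.
  by apply: (subsetP TS); rewrite !inE Bx -leqNgt le_ix.
case/andP=> Bx Sx; rewrite leqNgt; apply/negP => lt_xi.
by have := disjointFr LS (x := x); rewrite !inE Bx lt_xi Sx => /(_ isT).
Qed.

End Straightening.

(** * Independence: polytabloid functionals *)

Section Polytabloids.
Variables (K : fieldType) (n : nat).
Local Notation G := [set: 'S_n].

(** The coefficient functional at [z], antisymmetrized under right multiplication
    by each element of [ts], that is, the signed sum over the products of
    subsequences. When [ts] consists of disjoint transpositions, these products
    form the column group of a two-row tableau. *)
Fixpoint alternator (ts : seq 'S_n) (z : 'S_n) : 'cV[K]_#|G| :=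
  if ts is t :: ts' then (alternator ts' z - alternator ts' (z * t)%g)%R
  else delta_mx (gring_index G z) 0%R.

Lemma indicator_mul_delta (X : pred 'S_n) z :
  (indicator K X *m alternator [::] z = (X z)%:R%:M)%R.
Proof.
apply/matrixP => i j; rewrite !ord1 /= -colE !mxE.
by rewrite gring_indexK ?inE.
Qed.

Lemma alternator_invariant (X : pred 'S_n) t ts z :
  (forall p, X (p * t)%g = X p) -> (forall s, s \in ts -> commute s t) ->
  (indicator K X *m alternator ts (z * t)%g
   = indicator K X *m alternator ts z)%R.
Proof.
move=> Xt; elim: ts z => [|s ts IHts] z comm_t.
  by rewrite !indicator_mul_delta Xt.
rewrite /= !mulmxBr IHts => [|u us]; last by apply: comm_t; rewrite inE us orbT.
rewrite -mulgA -(comm_t s) ?mem_head // mulgA IHts // => u us.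
by apply: comm_t; rewrite inE us orbT.
Qed.

(** If [X] is invariant under an element of [ts], the terms cancel in pairs;
    pairing them keeps the argument valid in characteristic 2. *)
Lemma alternator_kill (X : pred 'S_n) t ts z :
  (forall p, X (p * t)%g = X p) -> {in ts &, forall s u, commute s u} ->
  t \in ts -> (indicator K X *m alternator ts z = 0)%R.
Proof.
move=> Xt; elim: ts z => // s ts IHts z comm_ts; rewrite inE => ts_t.
have comm_ts' : {in ts &, forall s u, commute s u}.
  by move=> u v us vs; apply: comm_ts; rewrite inE ?us ?vs orbT.
rewrite /= mulmxBr; case/predU1P: ts_t => [eq_t | ts_t]; last first.
  by rewrite !IHts ?subrr.
rewrite -eq_t alternator_invariant ?subrr // => u us.
by apply: comm_ts; rewrite inE ?us ?eq_t ?eqxx ?orbT.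
Qed.

Lemma commute_tperm (a b c d : 'I_n) :
  a != c -> a != d -> b != c -> b != d -> commute (tperm a b) (tperm c d).
Proof.
by move=> ac ad bc bd; rewrite /commute conjgC tpermJ !tpermD // eq_sym.
Qed.

Lemma weight_tperm (S : {set 'I_n}) (a b : 'I_n) :
  a \in S -> b \notin S -> b < a -> weight (tperm a b @: S) < weight S.
Proof.
move=> Sa Sb lt_ba; set t := tperm a b.
apply: (@weight_lt _ _ _ a); first by rewrite card_imset //; apply: perm_inj.
- apply: contraNneq Sb => <-; rewrite -[X in X \in _](tpermL a b).
  exact: imset_f.
- move=> _ /setDP[/imsetP[y Sy ->]]; rewrite /t; case: tpermP => // [_ | _ _].
    by rewrite Sa.
  by rewrite Sy.
move=> x /setDP[Sx]; have [-> // | nxa] := eqVneq x a; case/negP.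
apply/imsetP; exists x => //; rewrite tpermD 1?eq_sym //.
by apply: contraNneq Sb => <-.
Qed.

(** All the terms but the one at [z] evaluate the tabloid at a set lighter than
    the image of [R] under [z], hence lighter than [B]. *)
Lemma alternator_lead (R B : {set 'I_n}) (m : 'I_n -> 'I_n)
    (q : seq 'I_n) (z : 'S_n) :
  uniq q -> {in q &, injective m} ->
  {in q, forall s, [/\ s \in z @: R, m s \notin z @: R & m s < s]} ->
  weight (z @: R) <= weight B ->
  (indicator K (maps_onto R B) *m alternator [seq tperm s (m s) | s <- q] z
   = (z @: R == B)%:R%:M)%R.
Proof.
elim: q z => [|s q IHq] z; first by rewrite indicator_mul_delta.
move=> /= /andP[q's uniq_q] m_inj qP leB.
have sub_q x : x \in q -> x \in s :: q by rewrite inE => ->; rewrite orbT.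
have m_inj' : {in q &, injective m}.
  by move=> x y /sub_q qx /sub_q qy; apply: m_inj.
have [Rs Rms lt_ms] := qP s (mem_head _ _).
have lt_w : weight ((z * tperm s (m s))%g @: R) < weight (z @: R).
  by rewrite imset_permM weight_tperm.
have qP1 : {in q, forall x, [/\ x \in z @: R, m x \notin z @: R & m x < x]}.
  by move=> x /sub_q/qP.
have qP2 : {in q, forall x, [/\ x \in (z * tperm s (m s))%g @: R,
    m x \notin (z * tperm s (m s))%g @: R & m x < x]}.
  move=> x qx; have [Rx Rmx lt_mx] := qP1 x qx.
  have fix_x : tperm s (m s) x = x.
    by rewrite tpermD //; [apply: contraNneq q's | apply: contraNneq Rms] => ->.
  have fix_mx : tperm s (m s) (m x) = m x.
    rewrite tpermD //; first by apply: contraNneq Rmx => <-.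
    by apply: contraNneq q's => /m_inj->; rewrite ?mem_head ?sub_q.
  rewrite imset_permM; split=> //.
    by rewrite -[X in X \in _]fix_x mem_imset //; apply: perm_inj.
  by rewrite -[X in X \notin _]fix_mx mem_imset //; apply: perm_inj.
rewrite mulmxBr !IHq //; last by apply: leq_trans (ltnW lt_w) leB.
suff -> : ((z * tperm s (m s))%g @: R == B) = false by rewrite raddf0 subr0.
by apply: contraTF lt_w => /eqP ->; rewrite -leqNgt.
Qed.


(** There are more columns of length 2 than elements of [B], so that some
    transposition fixes [B] pointwise. *)
Lemma alternator_kill_small (S A B : {set 'I_n}) (m : 'I_n -> 'I_n) z :
  {in S &, injective m} -> {in S, forall s, m s \notin S} ->
  #|B| < #|S| ->
  (indicator K (maps_onto A B) *m alternator [seq tperm s (m s) | s <- enum S] z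
   = 0)%R.
Proof.
move=> m_inj mS ltBS.
have [s [Ss Bs Bms]] : exists s, [/\ s \in S, s \notin B & m s \notin B].
  pose f s := if s \in B then s else m s.
  have f_inj : {in S &, injective f}.
    move=> x y Sx Sy; rewrite /f; do 2!case: ifP => _ //.
    - by move=> eqx; have := mS y Sy; rewrite -eqx Sx.
    - by move=> eqy; have := mS x Sx; rewrite eqy Sy.
    by apply: m_inj.
  have /subsetPn[_ /imsetP[s Ss ->] Bfs] : ~~ (f @: S \subset B).
    apply: contraL ltBS => /subset_leq_card.
    by rewrite card_in_imset // -leqNgt.
  by exists s; move: Bfs; rewrite /f; case: ifP => [-> // | /negbT].
apply: (@alternator_kill _ (tperm s (m s))).
- move=> p; rewrite /maps_onto imset_permM perm_imset_eq tpermV eq_sym.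
  suff -> : tperm s (m s) @: B = B by [].
  rewrite -[RHS]imset_id; apply: eq_in_imset => x Bx.
  by rewrite tpermD //; [apply: contraNneq Bs | apply: contraNneq Bms] => ->.
- move=> _ _ /mapP[x Sx ->] /mapP[y Sy ->]; rewrite !mem_enum in Sx Sy.
  have [-> // | nxy] := eqVneq x y.
  apply: commute_tperm => //; last by apply: contraNneq nxy => /m_inj->.
  + by apply: contraTneq Sx => ->; apply: mS.
  by apply: contraTneq Sy => <-; apply: mS.
by apply: map_f; rewrite mem_enum.
Qed.

End Polytabloids.

(** * Dimension of the cell module, and the sum of squares *)

Section Dimension.
Variables (K : fieldType) (n k : nat).
Hypotheses (n_gt1 : 1 < n) (le_kn : k.*2 <= n).
Local Notation G := [set: 'S_n].
Local Notation R := (second_row n k).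
Local Notation U := (cell_ideal K n [:: n - k; k]).
Local Notation V :=
  (cyclic_mx (regular_repr K G) (young_sum_row K [:: n - k; k] 1%g)).
Local Notation tabloid := (fun B => indicator K (maps_onto R B)).

(** The pairing with the polytabloid of the standard tableau with second row [S]. *)
Lemma exists_polytabloid (S : {set 'I_n}) : S \in ballot_sets n k ->
  exists f : 'cV[K]_#|G|,
    (U *m f = 0)%R /\
    forall B, weight S <= weight B -> (tabloid B *m f = (S == B)%:R%:M)%R.
Proof.
rewrite inE => /andP[/ballot_matching[m [m_inj mP]] /eqP cardS].
have card_k : #|R| = k by apply: card_second_row; lia.
have [z def_S] := exists_perm_imset (etrans card_k (esym cardS)).
exists (alternator K [seq tperm s (m s) | s <- enum S] z); split=> [|B leB].
  apply/sub_kermxP/cell_ideal_sub => // A B ltAk eqAB; apply/sub_kermxP.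
  apply: alternator_kill_small => //; last by rewrite cardS -eqAB.
  by move=> s /mP[].
rewrite alternator_lead ?def_S ?enum_uniq // => [x y | x]; rewrite !mem_enum.
  exact: m_inj.
by move=> Sx; have [] := mP x Sx.
Qed.

(** The values of the polytabloid functionals on the ballot tabloids form a
    unitriangular matrix for the order by weight, and these functionals vanish
    on the cell ideal. *)
Lemma rank_section : \rank (U + V)%MS = \rank U + #|ballot_sets n k|.
Proof.
set N := #|ballot_sets n k|; pose std (i : 'I_N) : {set 'I_n} := enum_val i.
have std_inj : injective std by apply: enum_val_inj.
have std_ballot i : std i \in ballot_sets n k by apply: enum_valP.
pose E := (\matrix_(i < N) tabloid (std i))%R.
have std_card i : #|std i| = k.
  by have := std_ballot i; rewrite inE => /andP[_ /eqP].
have sEV : (E <= V)%MS.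
  by apply/row_subP => i; rewrite rowK mem_permutation_module.
apply/eqP; rewrite eqn_leq; apply/andP; split.
  apply: leq_trans (leq_trans (mxrank_adds_leqif U E) _); last first.
    by rewrite leq_add2l rank_leq_row.
  apply: mxrankS; rewrite addsmx_sub addsmxSl.
  apply: permutation_module_sub => // B cardB.
  apply: submx_trans (tabloid_span K n_gt1 le_kn cardB) _.
  rewrite addsmx_sub addsmxSl; apply/sumsmx_subP => S ballotS; rewrite genmxE.
  apply: submx_trans (addsmxSr _ _).
  apply: (eq_row_sub (enum_rank_in ballotS S)).
  by rewrite rowK /std enum_rankK_in.
have [f fP] := fin_all_exists (fun i => exists_polytabloid (std_ballot i)).
pose F := (\matrix_(p, j) f j p 0)%R : 'M_(_, N).
have colF j : col j F = f j by apply/colP => p; rewrite !mxE.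
have UF0 : (U *m F = 0)%R.
  apply/matrixP => i j; have [/matrixP/(_ i 0%R)] := fP j.
  rewrite -colF !mxE => fP0 _; rewrite -[RHS]fP0.
  by apply: eq_bigr => p _; rewrite !mxE.
have EF i j : weight (std j) <= weight (std i) ->
    (E *m F)%R i j = (j == i)%:R%R.
  have [_ fE] := fP j; move/fE/matrixP/(_ 0 0)%R.
  rewrite (inj_eq std_inj) -colF !mxE => {fE} fE.
  rewrite -[RHS]fE; apply: eq_bigr => p _; rewrite !mxE; congr (_ * _)%R.
have free_EF : row_free (E *m F)%R.
  apply: inj_row_free => v vEF0; apply/rowP => j; rewrite [RHS]mxE.
  (* Triangularity: column [j] involves only [j] and sets lighter than it,
     whose coordinates are already known to vanish. *)
  have [c] := ubnP (weight (std j)); elim: c => // c IHc in j * => lejc.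
  have := congr1 (fun w : 'rV_N => w 0%R j) vEF0.
  rewrite ![_ 0%R j]mxE (bigD1 j) //= EF // eqxx mulr1 big1 ?addr0 // => i nij.
  have [lt_ij | le_ji] := ltnP (weight (std i)) (weight (std j)).
    by rewrite IHc ?mul0r //; lia.
  by rewrite EF // eq_sym (negPf nij) mulr0.
rewrite -(mxrank_mul_ker (U + V)%MS F) addnC leq_add //.
  have /eqP rank_EF := free_EF; apply: (@leq_trans (\rank (E *m F)%R)).
    by rewrite rank_EF.
  by rewrite mxrankS // submxMr // (submx_trans sEV) ?addsmxSr.
by rewrite mxrankS // sub_capmx addsmxSl; apply/sub_kermxP.
Qed.

Lemma rdegree_Specht_two_rows :
  rdegree (Specht K n [:: n - k; k]) = walks n (n - k.*2).
Proof.
rewrite -card_ballot_sets //; apply/eqP.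
rewrite -(eqn_add2l (\rank U)) -rank_section -mxrank_in_factmod addnC.
by rewrite /= mxrank_gen.
Qed.

End Dimension.

Theorem theorem4p15 (K : fieldType) (m : nat) (hm : 0 < m) :
  \sum_(0 <= k < ((m + 1) %/ 2).+1)
     (rdegree (Specht K (m + 1) [:: m + 1 - k; k])) ^ 2
  = rdegree (Specht K (2 * m + 2) [:: m + 1; m + 1]).
Proof.
have -> : rdegree (Specht K (2 * m + 2) [:: m + 1; m + 1]) = walks (m + 1).*2 0.
  have {1}-> : m + 1 = 2 * m + 2 - (m + 1) by lia.
  rewrite rdegree_Specht_two_rows; [|lia..].
  by congr walks; lia.
under eq_big_nat => k lt_k.
  rewrite rdegree_Specht_two_rows; [| lia | by move: lt_k; rewrite divn2; lia].
  over.
rewrite -sum_walks_sqr.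
rewrite (sum_parity (F := fun h => walks (m + 1) h ^ 2));
  last by move=> h /walks_parity->.
set n := m + 1.
rewrite -(big_mkord xpredT (fun h => walks n h ^ 2)).
rewrite -[RHS](big_mkord xpredT (fun h => walks n h * walks n h)).
rewrite [RHS](@big_cat_nat _ _ _ n.+1) //=; last by lia.
rewrite [X in _ = _ + X]big_nat_cond [X in _ = _ + X]big1 ?addn0 => [|h].
  by apply: eq_bigr => h _; rewrite mulnn.
by rewrite andbT => /andP[lt_nh _]; rewrite walks_gt.
Qed.
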